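(* Let $G_1$ be an $r_1$-regular graph on $n_1$ vertices and $m_1$ edges, and $G_2$ an arbitrary graph on $n_2$ vertices. Then $$t(G_1\dot{\vee} G_2)=\frac{2^{m_1-n_1}\cdot(2n_1+2n_2+n_1r_1)\cdot\prod_{i=2}^{n_2}\Big(n_1+\mu_i(G_2)\Big)\cdot\prod_{i=2}^{n_1}\Big(2n_2+\mu_i(G_1)\Big)}{m_1+n_1+n_2}.$$
   Context: All graphs are finite, simple and undirected, with at least one vertex. $t(G)$ denotes the number of spanning trees of $G$. For a graph $G$ on $n$ vertices, $0=\mu_1(G)\le\mu_2(G)\le\cdots\le\mu_n(G)$ are the eigenvalues of the Laplacian matrix $L(G)=D(G)-A(G)$ ($D(G)$ the diagonal degree matrix, $A(G)$ the adjacency matrix). The subdivision graph $\mathcal{S}(G)$ is obtained from $G$ by inserting a new vertex into every edge of $G$. For vertex-disjoint graphs $G_1,G_2$, the subdivision-vertex join $G_1\dot{\vee}G_2$ is the graph obtained from $\mathcal{S}(G_1)$ and $G_2$ by joining every vertex of $V(G_1)$ (the original vertices) with every vertex of $V(G_2)$. *)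

(* Defs.v *)
From HB Require Import structures.
From mathcomp Require Import all_boot all_order all_algebra all_field.

Set Implicit Arguments.
Unset Strict Implicit.
Unset Printing Implicit Defensive.

Import Order.TTheory GRing.Theory Num.Theory.
Local Open Scope ring_scope.

Record sgraph := SGraph {
  svertex :> finType;
  adj : rel svertex;
  adj_sym : symmetric adj;
  adj_irr : irreflexive adj;
  sgraph_nonempty : (0 < #|svertex|)%N
}.
Arguments adj {s} _ _.

Definition edges (G : sgraph) : {set {set G}} :=
  [set [set p.1; p.2] | p : G * G & adj p.1 p.2].

Definition deg (G : sgraph) (x : G) : nat := #|[set y | adj x y]|.

Definition regular (G : sgraph) (r : nat) : Prop := forall x : G, deg x = r.

Lemma mem_edges (G : sgraph) (x y : G) : ([set x; y] \in edges G) = adj x y.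
Proof.
apply/imsetP/idP => [[[u v]] /= | xy]; last by exists (x, y); rewrite ?inE.
rewrite inE /= => uv E; move: uv.
have := set21 u v; have := set22 u v; rewrite -E.
by move=> /set2P[]-> /set2P[]->; rewrite ?adj_irr // adj_sym.
Qed.

Section Trees.
Variables (V : finType) (e : rel V).

Definition connectedb : bool := [forall x, forall y, connect e x y].

(* A cycle of a simple graph is a duplicate-free closed walk with at least
   three vertices: on an edge x -- y, [ucycle] also accepts [:: x; y]. *)
Definition acyclicb : bool :=
  [forall n : 'I_(#|V|.+1), forall c : n.-tuple V,
     ucycleb e c ==> (size c < 3)%N].

Lemma acyclicP :
  reflect (forall c : seq V, ucycle e c -> (size c < 3)%N) acyclicb.
Proof.
apply: (iffP forallP) => [acyc c uc | acyc n]; last first.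
  by apply/forallP => c; apply/implyP => /acyc.
have lt_c : (size c < #|V|.+1)%N.
  by rewrite ltnS -(card_uniqP (ucycle_uniq uc)) max_card.
by have /forallP/(_ (in_tuple c))/implyP/(_ uc) := acyc (Ordinal lt_c).
Qed.

Definition is_tree : bool := connectedb && acyclicb.

End Trees.

Definition edge_rel (V : finType) (F : {set {set V}}) : rel V :=
  [rel x y | [set x; y] \in F].

Definition spanning_trees (G : sgraph) : {set {set {set G}}} :=
  [set F : {set {set G}} | (F \subset edges G) && is_tree (edge_rel F)].

Definition t (G : sgraph) : nat := #|spanning_trees G|.

Definition degree_mx (G : sgraph) : 'M[algC]_#|G| :=
  diag_mx (\row_i (deg (enum_val i))%:R).

Definition adjacency_mx (G : sgraph) : 'M[algC]_#|G| :=
  \matrix_(i, j) (adj (enum_val i) (enum_val j))%:R.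

Definition laplacian (G : sgraph) : 'M[algC]_#|G| :=
  degree_mx G - adjacency_mx G.

(* The roots of the characteristic polynomial, with multiplicity. The order
   of [algC] is only partial, but these roots are real, so that sorting is
   meaningful: see [laplacian_spectrum_sorted]. *)
Definition laplacian_spectrum (G : sgraph) : seq algC :=
  sort <=%R (sval (closed_field_poly_normal (char_poly (laplacian G)))).

(* Indexed from 1: mu_1, ..., mu_n with n = #|G|. *)
Definition mu (G : sgraph) (i : nat) : algC := (laplacian_spectrum G)`_i.-1.

Lemma laplacian_char_poly (G : sgraph) :
  char_poly (laplacian G) = \prod_(x <- laplacian_spectrum G) ('X - x%:P).
Proof.
rewrite /laplacian_spectrum; case: closed_field_poly_normal => s /= def_p.
rewrite {}def_p (monicP (char_poly_monic _)) scale1r.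
by apply: perm_big; rewrite perm_sym perm_sort.
Qed.

Lemma size_laplacian_spectrum (G : sgraph) :
  size (laplacian_spectrum G) = #|G|.
Proof.
apply: succn_inj; rewrite -(size_char_poly (laplacian G)) laplacian_char_poly.
by rewrite size_prod_XsubC.
Qed.

Lemma mem_laplacian_spectrum (G : sgraph) x :
  (x \in laplacian_spectrum G) = eigenvalue (laplacian G) x.
Proof.
by rewrite eigenvalue_root_char laplacian_char_poly root_prod_XsubC.
Qed.

Lemma deg_sum (G : sgraph) (i : 'I_#|G|) :
  (deg (enum_val i))%:R
    = \sum_(j < #|G|) (adj (enum_val i) (enum_val j))%:R :> algC.
Proof.
move: (enum_val i) => x.
have <- := big_enum_val (fun y : G => (adj x y)%:R : algC).
rewrite /deg -sum1_card natr_sum big_mkcond /=; apply: eq_bigr => y _.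
by rewrite inE; case: adj.
Qed.

Lemma laplacian_spectrum_ge0 (G : sgraph) :
  {in laplacian_spectrum G, forall x, 0 <= x}.
Proof.
move=> x; rewrite mem_laplacian_spectrum => /eigenvalueP[v vL v0].
pose a (i j : 'I_#|G|) : algC := (adj (enum_val i) (enum_val j))%:R.
have aC i j : a i j = a j i by rewrite /a adj_sym.
have E j : x * v 0 j = \sum_i a i j * (v 0 j - v 0 i).
  have /rowP/(_ j) := vL; rewrite mulmxBr mul_mx_diag !mxE deg_sum => <-.
  under [RHS]eq_bigr do rewrite mulrBr.
  rewrite sumrB -mulr_suml mulrC; congr (_ * _ - _).
    by apply: eq_bigr => i _; rewrite aC.
  by apply: eq_bigr => i _; rewrite !mxE mulrC.
have E2 : x * (\sum_j `|v 0 j| ^+ 2) *+ 2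
        = \sum_j \sum_i a i j * `|v 0 j - v 0 i| ^+ 2.
  have F : x * (\sum_j `|v 0 j| ^+ 2)
         = \sum_j \sum_i a i j * ((v 0 j - v 0 i) * (v 0 j)^*).
    rewrite mulr_sumr; apply: eq_bigr => j _.
    rewrite normCK mulrA E mulr_suml.
    by apply: eq_bigr => i _; rewrite mulrA.
  rewrite mulr2n {1}F exchange_big F -big_split; apply: eq_bigr => j _.
  rewrite -big_split; apply: eq_bigr => i _ /=.
  rewrite (aC j i) -mulrDr normCK rmorphB /=; congr (_ * _).
  by rewrite mulrBr addrC -[v 0 i - _]opprB mulNr.
have pos : 0 < \sum_j `|v 0 j| ^+ 2.
  have sq_ge0 i : true -> 0 <= `|v 0 i| ^+ 2 by rewrite exprn_ge0.
  rewrite lt_neqAle eq_sym sumr_ge0 // andbT.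
  apply: contraNneq v0 => /(psumr_eq0P sq_ge0) Z; apply/eqP/rowP => j.
  by rewrite mxE; apply/eqP; rewrite -normr_eq0 -sqrf_eq0 Z.
rewrite -(pmulr_lge0 _ pos) -(pmulrn_lge0 _ (isT : 0 < 2)%N) E2.
apply: sumr_ge0 => j _; apply: sumr_ge0 => i _.
by rewrite mulr_ge0 ?ler0n ?exprn_ge0.
Qed.

Lemma laplacian_spectrum_sorted (G : sgraph) :
  sorted <=%R (laplacian_spectrum G).
Proof.
apply: (@sort_sorted_in _ [pred x : algC | 0 <= x]) => [x y|].
  rewrite !inE => /ger0_real x_real /ger0_real; exact: real_leVge.
apply/allP => x x_s; rewrite inE (@laplacian_spectrum_ge0 G) //.
by rewrite mem_sort.
Qed.

Lemma mu1_eq0 (G : sgraph) : mu G 1 = 0.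
Proof.
have: 0 \in laplacian_spectrum G.
  rewrite mem_laplacian_spectrum; apply/eigenvalueP; exists (const_mx 1).
    apply/rowP => j; rewrite scale0r mulmxBr mul_mx_diag !mxE deg_sum mul1r.
    apply/eqP; rewrite subr_eq0; apply/eqP; apply: eq_bigr => i _.
    by rewrite !mxE mul1r adj_sym.
  apply/eqP => /rowP/(_ (Ordinal (sgraph_nonempty G))).
  by rewrite !mxE => /eqP; rewrite oner_eq0.
have := @laplacian_spectrum_ge0 G; have := laplacian_spectrum_sorted G.
rewrite /mu; case: laplacian_spectrum => //= x s.
rewrite (path_sortedE le_trans) => /andP[/allP x_le _] ge0.
rewrite inE => /predU1P[-> // | /x_le x_le0].
by apply/eqP; rewrite eq_le x_le0 ge0 ?mem_head.
Qed.

Section Subdivision.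
Variable G : sgraph.

Definition subdiv_vertex : finType := (G + {e : {set G} | e \in edges G})%type.

Definition subdiv_adj : rel subdiv_vertex := fun u v =>
  match u, v with
  | inl x, inr e => x \in val e
  | inr e, inl x => x \in val e
  | _, _ => false
  end.

Fact subdiv_sym : symmetric subdiv_adj. Proof. by move=> [x|e] [y|f]. Qed.
Fact subdiv_irr : irreflexive subdiv_adj. Proof. by move=> [x|e]. Qed.
Fact subdiv_nonempty : (0 < #|subdiv_vertex|)%N.
Proof. by rewrite card_sum addn_gt0 sgraph_nonempty. Qed.

Definition subdivision : sgraph :=
  SGraph subdiv_sym subdiv_irr subdiv_nonempty.

End Subdivision.

Section SubdivisionVertexJoin.
Variables G1 G2 : sgraph.

Definition svjoin_vertex : finType := (subdivision G1 + G2)%type.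

Definition svjoin_adj : rel svjoin_vertex := fun u v =>
  match u, v with
  | inl x, inl y => adj x y
  | inr x, inr y => adj x y
  | inl (inl _), inr _ => true
  | inr _, inl (inl _) => true
  | _, _ => false
  end.

Fact svjoin_sym : symmetric svjoin_adj.
Proof.
by move=> [[x|e]|x] [[y|f]|y] //=; apply: adj_sym.
Qed.

Fact svjoin_irr : irreflexive svjoin_adj.
Proof. by move=> [[x|e]|x] //=; apply: adj_irr. Qed.

Fact svjoin_nonempty : (0 < #|svjoin_vertex|)%N.
Proof. by rewrite card_sum addn_gt0 sgraph_nonempty. Qed.

Definition svjoin : sgraph := SGraph svjoin_sym svjoin_irr svjoin_nonempty.

End SubdivisionVertexJoin.

(* Main.v *)
Require Import Defs.
From mathcomp Require Import all_boot all_order all_fingroup all_algebra all_field.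
From mathcomp Require Import ring.

(* Expanding the determinant of the Laplacian, with 1 added at the diagonal
   entry of a root r, along its rows gives a sum over parent functions f; the
   term of f is 1 when every vertex flows along f to the fixpoint r, and 0
   otherwise.  Such f are the orientations of the spanning trees towards r,
   whence the matrix-tree theorem.  As L has zero row and column sums, it takes
   the form det(L + u v^T) = (sum u) (sum v) t(G) for all vectors u and v.
   For the subdivision-vertex join, u = 1 on V(G1) and v = 1 on V(G1) and V(G2)
   make L + u v^T block triangular, and a Schur complement eliminates the
   subdivision vertices: since R R^T = r1 + A(G1) for the incidence matrix R of
   G1, what remains is a product of shifted Laplacian determinants of G1 and
   G2. *)

Set Implicit Arguments.
Unset Strict Implicit.
Unset Printing Implicit Defensive.

Import Order.TTheory GRing.Theory Num.Theory.
Local Open Scope ring_scope.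

(** * Parent functions *)

Section FunctionalDigraph.
Variables (F : fieldType) (V : finType).

Definition flows_to_fixpoint (f : {ffun V -> V}) : bool :=
  [forall x, exists y, fconnect f x y && (f y == y)].

(** Laplacian of the digraph with arcs from x to [f x], where the row of a fixpoint is a unit
    vector, as for a root. *)
Definition fun_laplacian (f : {ffun V -> V}) : 'M[F]_#|V| :=
  \matrix_(i, j) ((i == j)%:R -
    ((f (enum_val i) != enum_val i) && (f (enum_val i) == enum_val j))%:R).

Lemma flows_to_fixpointP (f : {ffun V -> V}) :
  reflect (forall x, exists n, f (iter n f x) == iter n f x) (flows_to_fixpoint f).
Proof.
apply: (iffP forallP) => [h x | h x].
  have /existsP[y /andP[/iter_findex <- fy]] := h x.
  by exists (findex f x y).
have [n fn] := h x; apply/existsP; exists (iter n f x).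
by rewrite fconnect_iter.
Qed.

Lemma det_fun_laplacian f : \det (fun_laplacian f) = (flows_to_fixpoint f)%:R.
Proof.
case: flows_to_fixpointP => [h | /flows_to_fixpointP/forallPn[x0 x0P]]; last first.
  (* The vertices that reach no fixpoint form a set closed under [f] and its
     preimages, so the indicator of that set is in the kernel. *)
  pose S := [pred x | ~~ [exists y, fconnect f x y && (f y == y)]].
  have Sf x : (f x \in S) = (x \in S).
    rewrite !inE; congr (~~ _); apply/existsP/existsP => -[y /andP[c fy]].
      by exists y; rewrite fy (connect_trans (fconnect1 f x)).
    exists y; rewrite fy andbT; move: fy; rewrite -(iter_findex c) => /eqP <-.
    by rewrite -iterS iterSr fconnect_iter.
  apply/eqP; rewrite -det_tr; apply/det0P.
  exists (\row_i (enum_val i \in S)%:R).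
    apply/eqP => /rowP/(_ (enum_rank x0)).
    by rewrite !mxE enum_rankK inE x0P => /eqP; rewrite oner_eq0.
  apply/rowP => i; rewrite !mxE.
  under eq_bigr do rewrite !mxE mulrBr.
  rewrite sumrB (bigD1 i) //= eqxx mulr1 big1 ?addr0; last first.
    by move=> j /negPf ji; rewrite eq_sym ji mulr0.
  case: (eqVneq (f (enum_val i)) (enum_val i)) => /= [fi | fi].
    have -> : (enum_val i \in S) = false.
      by rewrite inE; apply/negbF/existsP; exists (enum_val i); rewrite connect0 fi /=.
    by rewrite big1 ?subr0 // => j _; rewrite mulr0.
  rewrite (bigD1 (enum_rank (f (enum_val i)))) //= enum_rankK eqxx mulr1 Sf.
  rewrite big1 ?addr0 ?subrr // => j.
  have [-> | _ _] := eqVneq (f (enum_val i)) (enum_val j).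
    by rewrite enum_valK eqxx.
  by rewrite mulr0.
(* [d] strictly decreases along non-loops, so a permutation [s] other than the
   identity has a zero factor at a moved point [i] of minimal [d]: [s i = f i]
   would be a moved point of smaller [d]. *)
pose d x := ex_minn (h x).
have d_lt x : f x != x -> (d (f x) < d x)%N.
  rewrite /d; case: (ex_minnP (h x)) => -[|n] /= fn _; first by rewrite fn.
  by case: ex_minnP => m _ m_le _; rewrite ltnS; apply: m_le; rewrite -iterSr.
rewrite /determinant (bigD1 (1%g : {perm _})) //= odd_perm1 expr0 mul1r.
rewrite [X in X + _]big1 ?[X in 1 + X]big1 ?addr0 //; last first.
  move=> i _; rewrite mxE perm1 eqxx.
  by case: eqP => //=; rewrite ?subr0.
move=> s s1; have [i0 si0] : exists i, s i != i.
  apply/existsP; apply: contraNT s1 => /existsPn h1.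
  by apply/eqP/permP => i; rewrite perm1; apply/eqP; have := h1 i; rewrite negbK.
case: (@arg_minnP _ i0 (fun i => s i != i) (fun i => d (enum_val i)) si0) => i si i_min.
suff E : fun_laplacian f i (s i) = 0 by rewrite (bigD1 i) //= E mul0r mulr0.
rewrite mxE eq_sym (negPf si).
have [-> | fi] := eqVneq; first by rewrite subr0.
have [fsi | _] := eqVneq; last by rewrite subr0.
have : (d (enum_val (s i)) < d (enum_val i))%N by rewrite -fsi d_lt.
rewrite ltnNge i_min //; apply: contra_neq si => /perm_inj E.
by rewrite E.
Qed.

End FunctionalDigraph.

(** Multilinearity in the rows: row x combines, with weights [W x y], the rows that
    [fun_laplacian f] has at x when [f x = y]. Expanding all rows amounts to choosing f. *)
Lemma det_sum_parent (F : fieldType) (V : finType) (W : V -> V -> F) :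
  \det (\matrix_(i, j < #|V|) \sum_y W (enum_val i) y * ((i == j)%:R -
     ((y != enum_val i) && (y == enum_val j))%:R)) =
  \sum_(f : {ffun V -> V}) (\prod_x W x (f x)) * (flows_to_fixpoint f)%:R.
Proof.
under [RHS]eq_bigr do rewrite -det_fun_laplacian /determinant mulr_sumr.
rewrite /determinant exchange_big; apply: eq_bigr => s _.
under [RHS]eq_bigr do rewrite mulrCA.
rewrite -mulr_sumr; congr (_ * _).
have reE (G : 'I_#|V| -> F) : \prod_i G i = \prod_x G (enum_rank x).
  by rewrite (reindex _ (onW_bij _ (@enum_rank_bij V))).
rewrite reE.
under eq_bigr do rewrite mxE enum_rankK.
rewrite bigA_distr_bigA /=; apply: eq_bigr => f _.
rewrite big_split reE; congr (_ * _); apply: eq_bigr => x _.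
by rewrite mxE enum_rankK.
Qed.

(** * Spanning trees and parent functions *)

Section RootedTrees.
Variables (G : sgraph) (r : G).
Implicit Types (f g : {ffun G -> G}) (F : {set {set G}}).

Definition parent_fun f : bool :=
  [&& f r == r, [forall (x | x != r), adj x (f x)] & [forall x, fconnect f x r]].

Definition parent_edges f : {set {set G}} := [set [set x; f x] | x in [set~ r]].

Lemma parent_funP f :
  reflect [/\ f r = r, forall x, x != r -> adj x (f x) & forall x, fconnect f x r]
          (parent_fun f).
Proof.
by apply: (iffP and3P) => -[/eqP fr h1 h2]; split=> //; first [exact/forall_inP | exact/forallP].
Qed.

Lemma edge_relP f x y :
  reflect ((x != r /\ y = f x) \/ (y != r /\ x = f y)) (edge_rel (parent_edges f) x y).
Proof.
apply: (iffP imsetP) => /= [[z]|].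
  rewrite !inE => zr E.
  have xE : x \in [set z; f z] by rewrite -E set21.
  have yE : y \in [set z; f z] by rewrite -E set22.
  have zE : z \in [set x; y] by rewrite E set21.
  have fE : f z \in [set x; y] by rewrite E set22.
  case/set2P: xE => xE; case/set2P: yE => yE; subst; try by [left | right].
    by case/set2P: fE => fE; left.
  by case/set2P: zE => zE; left; rewrite -?zE; split=> //; rewrite -zE.
by case=> -[zr ->]; [exists x | exists y]; rewrite ?inE // setUC.
Qed.

Lemma edge_rel_sym F : symmetric (edge_rel F).
Proof. by move=> x y; rewrite /edge_rel /= setUC. Qed.

Lemma findex_parent f x : parent_fun f -> x != r ->
  findex f x r = (findex f (f x) r).+1.
Proof. by case/parent_funP=> _ _ fc xr; rewrite fconnect_findex // eq_sym. Qed.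

Lemma parent_edges_sub f : parent_fun f -> parent_edges f \subset edges G.
Proof.
case/parent_funP=> _ fe _; apply/subsetP => _ /imsetP[x xr ->].
by rewrite mem_edges fe //; rewrite !inE in xr.
Qed.

Lemma parent_edges_connected f : parent_fun f ->
  connectedb (edge_rel (parent_edges f)).
Proof.
case/parent_funP=> fr _ fc.
have sym : connect_sym (edge_rel (parent_edges f)).
  exact/sym_connect_sym/edge_rel_sym.
have cr x : connect (edge_rel (parent_edges f)) x r.
  apply: connect_sub (fc x) => y _ /eqP <-.
  have [-> | yr] := eqVneq y r; first by rewrite fr.
  by apply: connect1; apply/edge_relP; left.
by apply/forallP => x; apply/forallP => y; apply: connect_trans (cr x) _; rewrite sym.
Qed.

(** On a cycle, take a vertex x farthest from [r] along f. A neighbour of x on the cycle other than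
    [f x] would have parent x and lie farther away; so both neighbours are [f x], impossible with
    three or more distinct vertices. *)
Lemma parent_edges_acyclic f : parent_fun f ->
  acyclicb (edge_rel (parent_edges f)).
Proof.
move=> pf; apply/acyclicP => c /andP[cyc uc]; rewrite ltnNge; apply/negP => c3.
have [x xc x_max] : exists2 x, x \in c & {in c, forall y, (findex f y r <= findex f x r)%N}.
  have [x0 x0c] : exists x0, x0 \in c by case: (c) c3 => // x s _; exists x; rewrite mem_head.
  by have [x xc x_max] := @arg_maxnP _ x0 (mem c) (fun y => findex f y r) x0c; exists x.
have nbr y : y \in c -> edge_rel (parent_edges f) x y -> y = f x.
  move=> yc /edge_relP[[] // | [yr xE]].
  by have := x_max _ yc; rewrite (findex_parent pf yr) -xE ltnn.
have [i s def_c] := rot_to xc.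
have sub_c : {subset x :: s <= c} by move=> z; rewrite -def_c mem_rot.
have : size (x :: s) = size c by rewrite -def_c size_rot.
move: cyc uc; rewrite -(rot_cycle i) -(rot_uniq i) def_c => + + sz; rewrite -{}sz in c3.
case: s => [|y s] // in def_c sub_c c3 *; case/lastP: s => [|s z] // in def_c sub_c c3 *.
rewrite /= rcons_path last_rcons => /andP[xy /andP[_ zx]].
case/and3P=> _ ynz _; case/negP: ynz.
have -> : y = f x by apply: nbr => //; rewrite sub_c // !inE eqxx orbT.
have <- : z = f x by apply: nbr; rewrite 1?edge_rel_sym ?sub_c // !inE mem_rcons mem_head !orbT.
by rewrite mem_rcons mem_head.
Qed.

Lemma parent_edges_inj : {in parent_fun &, injective parent_edges}.
Proof.
move=> f g pf pg E; apply/ffunP => x.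
have [n] := ubnP (findex f x r); elim: n x => // n IHn x /ltnSE le_n.
have [-> | xr] := eqVneq x r.
  by case/parent_funP: pf => -> _ _; case/parent_funP: pg => -> _ _.
have : edge_rel (parent_edges g) x (f x) by rewrite -E; apply/edge_relP; left.
(* If [x = g (f x)] rather than [f x = g x], induction at [f x] gives [f (f x) = x], and the depth
   of x would exceed itself by 2. *)
case/edge_relP=> [[] // | [fxr xE]].
have lt_n : (findex f (f x) r < n)%N by rewrite -(findex_parent pf).
have := findex_parent pf xr; rewrite (findex_parent pf fxr) (IHn _ lt_n) -xE.
by move/eqP; rewrite -addn2 -[X in X == _]addn0 eqn_add2l.
Qed.

(** Breadth-first search: [d x] is the length of a shortest path from x to [r], and the parent of x
    is a neighbour strictly closer to [r]. *)
Lemma connected_parent_fun (e : rel G) : (forall x y, e x y -> adj x y) ->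
  (forall x, connect e x r) -> exists2 f, parent_fun f & forall x, x != r -> e x (f x).
Proof.
move=> sub_e ce.
have h x : exists n, [exists p : n.-tuple G, path e x p && (last x p == r)].
  have /connectP[p ep lp] := ce x; exists (size p); apply/existsP; exists (in_tuple p).
  by rewrite ep -lp eqxx.
pose d x := ex_minn (h x).
pose f := [ffun x => if x == r then r else odflt r [pick y | e x y & (d y < d x)%N]].
have fP x : x != r -> e x (f x) /\ (d (f x) < d x)%N.
  move=> xr; rewrite ffunE (negPf xr); case: pickP => [y /andP[] // | no].
  have: exists y, e x y && (d y < d x)%N.
    rewrite /d; case: (ex_minnP (h x)) => n /existsP[[[|y p] /= /eqP <-]] /=.
      by rewrite (negPf xr).
    move=> /andP[/andP[xy yp] lp] _; exists y; rewrite xy ltnS.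
    case: ex_minnP => m _; apply; apply/existsP; exists (in_tuple p).
    by rewrite yp lp.
  by case=> y; rewrite no.
exists f; last by move=> x /fP[].
apply/parent_funP; split; first by rewrite ffunE eqxx.
  by move=> x /fP[/sub_e].
move=> x; have [n] := ubnP (d x); elim: n x => // n IHn x /ltnSE le_n.
have [-> // | /fP[_ lt_d]] := eqVneq x r.
by apply: connect_trans (fconnect1 f x) (IHn _ _); apply: leq_trans lt_d le_n.
Qed.

Lemma spanning_tree_parent F : F \in spanning_trees G ->
  exists2 f, parent_fun f & F = parent_edges f.
Proof.
rewrite inE => /and3P[sub_F conn_F /acyclicP acyc_F].
have [f pf ef] : exists2 f, parent_fun f & forall x, x != r -> edge_rel F x (f x).
  apply: connected_parent_fun => x; last by have /forallP/(_ r) := forallP conn_F x.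
  by move=> y xy; rewrite -mem_edges (subsetP sub_F).
have sub_e x y : edge_rel (parent_edges f) x y -> edge_rel F x y.
  by case/edge_relP=> -[/ef + ->] //; rewrite edge_rel_sym.
(* An edge of [F] outside the connected graph [parent_edges f] would close a
   cycle of [F]. *)
exists f => //; apply/eqP; rewrite eqEsubset andbC; apply/andP; split.
  by apply/subsetP=> _ /imsetP[x xr ->]; apply: ef; rewrite !inE in xr.
apply/subsetP => xy Fxy; have := subsetP sub_F _ Fxy.
case/imsetP=> -[x y]; rewrite inE /= => adj_xy E; rewrite {xy}E in Fxy *.
apply: contraT => notP.
have /forallP/(_ x)/forallP/(_ y)/connectP[p] := parent_edges_connected pf.
case/shortenP=> q ep uq _ yq.
have : ucycle (edge_rel F) (x :: q).
  rewrite /ucycle uq andbT /= rcons_path (sub_path _ ep) //=.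
  by rewrite -yq edge_rel_sym.
(* Only paths with at most one step remain: x = y contradicts irreflexivity, and a single step is
   itself an edge of [parent_edges f]. *)
move/acyc_F; case: q => [|z [|? ?]] // in ep uq yq * => _.
  by move: adj_xy; rewrite yq adj_irr.
by case/negP: notP; move: ep; rewrite /= andbT -[z]yq.
Qed.

(** Whatever the root, a spanning tree has exactly one orientation towards it. *)
Lemma card_spanning_trees : t G = #|[set f | parent_fun f]|.
Proof.
rewrite /t -(card_in_imset (f := parent_edges)); last first.
  by move=> f g; rewrite !inE; apply: parent_edges_inj.
apply: eq_card => F; apply/idP/imsetP => [/spanning_tree_parent[f pf ->] | [f]].
  by exists f; rewrite ?inE.
rewrite !inE => pf ->; rewrite parent_edges_sub // /is_tree.
by rewrite parent_edges_connected ?parent_edges_acyclic.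
Qed.

End RootedTrees.

(** * The matrix-tree theorem *)

Section RankOne.
Variable R : comNzRingType.

(** Matrix determinant lemma: clearing [v] in [B] by a unitriangular factor on the right or on the
    left gives the two sides. *)
Lemma det_rank1 n (u : 'cV[R]_n) (v : 'rV[R]_n) :
  \det (1%:M + u *m v) = 1 + \sum_i v 0 i * u i 0.
Proof.
pose B : 'M[R]_(n + 1) := block_mx 1%:M (- u) v 1%:M.
have -> : \det (1%:M + u *m v) = \det B.
  have: \det (B *m block_mx 1%:M 0 (- v) 1%:M) = \det (1%:M + u *m v).
    rewrite mulmx_block !mulmx1 !mulmx0 !add0r mul1mx mulNmx mulmxN opprK subrr.
    by rewrite det_ublock det1 mulr1.
  by rewrite det_mulmx det_lblock !det1 !mulr1.
have: \det (block_mx 1%:M 0 (- v) 1%:M *m B) = 1 + \sum_i v 0 i * u i 0.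
  rewrite mulmx_block !mul1mx !mul0mx !addr0 mulmx1 mulNmx mulmxN opprK addNr.
  by rewrite det_ublock det1 mul1r det_mx11 !mxE addrC.
by rewrite det_mulmx det_lblock !det1 !mul1r.
Qed.

(* Left multiplication by [1 + w 1^T] replaces [e_i] by [e_i + w]. *)
Lemma det_add_rank1_row n (A : 'M[R]_n) (u : 'cV[R]_n) (v : 'rV[R]_n) i :
    const_mx 1 *m A = 0 :> 'rV_n ->
  \det (A + u *m v) = (\sum_j u j 0) * \det (A + delta_mx i 0 *m v).
Proof.
move=> A0; pose w := u - delta_mx i 0.
have -> : A + u *m v =
    (1%:M + w *m const_mx 1) *m (A + delta_mx i 0 *m v).
  rewrite mulmxDl mul1mx mulmxDr -!mulmxA A0 mulmx0 add0r.
  have -> : const_mx 1 *m (delta_mx i 0 *m v) = v.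
    by apply/rowP => k; rewrite mulmxA -colE !mxE big_ord1 !mxE mul1r.
  by rewrite -addrA -mulmxDl addrCA subrr addr0.
rewrite det_mulmx det_rank1; congr (_ * _).
have delta1 : \sum_j (delta_mx i 0 : 'cV[R]_n) j 0 = 1.
  rewrite (bigD1 i) //= mxE !eqxx big1 ?addr0 // => j /negPf ji.
  by rewrite mxE ji.
under eq_bigr do rewrite mxE mul1r mxE [X in _ + X]mxE.
by rewrite sumrB delta1 addrC subrK.
Qed.

(** The row version, applied to [A] and then to its transpose, moves first [u] and then [v] to the
    unit vector at i. *)
Lemma det_add_rank1 n (A : 'M[R]_n) (u : 'cV[R]_n) (v : 'rV[R]_n) i :
    const_mx 1 *m A = 0 :> 'rV_n -> A *m const_mx 1 = 0 :> 'cV_n ->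
  \det (A + u *m v) =
    (\sum_j u j 0) * (\sum_j v 0 j) * \det (A + delta_mx i i).
Proof.
move=> A0 A0'; rewrite (det_add_rank1_row _ _ i A0) -mulrA; congr (_ * _).
rewrite -det_tr linearD /= trmx_mul trmx_delta (det_add_rank1_row _ _ i); last first.
  by apply: trmx_inj; rewrite trmx_mul trmxK trmx0 trmx_const.
rewrite mul_delta_mx -[X in _ + X]trmxK -linearD det_tr; congr (_ * _).
  by apply: eq_bigr => j _; rewrite mxE.
by rewrite trmx_delta.
Qed.

End RankOne.

Lemma sum_enum_val (F : zmodType) (T : finType) (f : T -> F) :
  \sum_(i < #|T|) f (enum_val i) = \sum_x f x.
Proof.
by rewrite [RHS](reindex _ (onW_bij _ (@enum_val_bij T))).
Qed.

Lemma deg_natr (G : sgraph) (x : G) : (deg x)%:R = \sum_y (adj x y)%:R :> algC.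
Proof.
rewrite /deg -sum1_card natr_sum big_mkcond; apply: eq_bigr => y _.
by rewrite inE; case: adj.
Qed.

Lemma laplacianE (G : sgraph) i j :
  laplacian G i j = (deg (enum_val i))%:R *+ (i == j)
                    - (adj (enum_val i) (enum_val j))%:R.
Proof. by rewrite !mxE. Qed.

Lemma laplacian_mul1 (G : sgraph) p : laplacian G *m const_mx 1 = 0 :> 'M_(_, p).
Proof.
apply/matrixP => i k; rewrite !mxE.
under eq_bigr do rewrite [X in _ * X]mxE mulr1 laplacianE.
rewrite sumrB -deg_sum (bigD1 i) //= eqxx big1 ?addr0 ?subrr // => j.
by rewrite eq_sym => /negPf->.
Qed.

Lemma laplacian_tr (G : sgraph) : (laplacian G)^T = laplacian G.
Proof.
apply/matrixP => i j; rewrite mxE !laplacianE adj_sym eq_sym.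
by case: eqP => [->|].
Qed.

Lemma laplacian_1mul (G : sgraph) p : const_mx 1 *m laplacian G = 0 :> 'M_(p, _).
Proof.
by apply: trmx_inj; rewrite trmx_mul trmx_const laplacian_tr laplacian_mul1 trmx0.
Qed.

Lemma det_laplacian_root (G : sgraph) (r : G) :
  \det (laplacian G + delta_mx (enum_rank r) (enum_rank r)) = (t G)%:R.
Proof.
(* The extra diagonal entry is encoded as a loop at [r]. *)
pose w x y := adj x y || (x == r) && (y == r).
pose W x y : algC := (w x y)%:R.
have -> : laplacian G + delta_mx (enum_rank r) (enum_rank r) =
    \matrix_(i, j < #|G|) \sum_y W (enum_val i) y * ((i == j)%:R -
     ((y != enum_val i) && (y == enum_val j))%:R).
  have WE x y : W x y = (adj x y)%:R + ((x == r) && (y == r))%:R.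
    rewrite /W /w; case: (boolP (adj x y)) => [xy|]; last by rewrite add0r.
    by case: andP => [[/eqP xr /eqP yr] | _]; rewrite ?addr0 //; rewrite xr yr adj_irr in xy.
  apply/matrixP => i j; rewrite mxE laplacianE !mxE -!(can2_eq enum_valK enum_rankK).
  under [RHS]eq_bigr do rewrite mulrBr.
  rewrite sumrB -mulr_suml.
  under eq_bigr do rewrite WE.
  rewrite big_split /= -deg_natr (bigD1 r) //= eqxx andbT big1 ?addr0; last first.
    by move=> y /negPf->; rewrite andbF.
  rewrite (bigD1 (enum_val j)) //= eqxx andbT [X in _ - (_ + X)]big1 ?addr0; last first.
    by move=> y /negPf->; rewrite andbF mulr0.
  rewrite WE (inj_eq enum_val_inj) (eq_sym j).
  have [<- | ij] /= := eqVneq i j.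
    by rewrite !mulr1 adj_irr mulr0 !subr0 andbb.
  rewrite mulr0 mulr1 sub0r add0r opprD; case: andP => [[/eqP ir /eqP jr] | _].
    by case/eqP: ij; apply: enum_val_inj; rewrite ir jr.
  by rewrite subr0 addr0.
rewrite det_sum_parent (card_spanning_trees r) -sum1_card natr_sum [RHS]big_mkcond /=.
apply: eq_bigr => f _; rewrite inE.
have -> : \prod_x W x (f x) = [forall x, w x (f x)]%:R.
  case: forallP => [h | /forallP/forallPn[x nx]]; first by rewrite big1 // => x _; rewrite /W h.
  by rewrite (bigD1 x) //= /W (negPf nx) mul0r.
rewrite -natrM mulnb; suff -> : [forall x, w x (f x)] && flows_to_fixpoint f = parent_fun r f.
  by case: parent_fun.
(* The weights allow no loop except at [r], so reaching a fixpoint means reaching [r]. *)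
apply/andP/parent_funP => [[/forallP wf /forallP sf] | [fr fe fc]].
  have fixr x : f x = x -> x = r.
    by move=> fx; have := wf x; rewrite /w fx adj_irr => /andP[/eqP].
  have fc x : fconnect f x r /\ f r = r.
    by have /existsP[y /andP[xy /eqP fy]] := sf x; rewrite -(fixr y fy).
  split; [by case: (fc r) | | by move=> x; case: (fc x)].
  by move=> x /negPf xr; have := wf x; rewrite /w xr orbF.
split; apply/forallP => x.
  have [-> | xr] := eqVneq x r; first by rewrite /w fr !eqxx orbT.
  by rewrite /w fe.
by apply/existsP; exists r; rewrite fc fr eqxx.
Qed.

(** Rows and columns undergo the same permutation, so the signs cancel. Vertices can thus be listed
    block by block. *)
Lemma det_reindex (R : comNzRingType) (T : finType) n (h : 'I_n -> T)
    (M : T -> T -> R) : bijective h ->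
  \det (\matrix_(i, j) M (h i) (h j)) =
  \det (\matrix_(i, j < #|T|) M (enum_val i) (enum_val j)).
Proof.
move=> bij_h; have En : n = #|T| by rewrite -(bij_eq_card bij_h) card_ord.
move: h bij_h; rewrite En => h bij_h.
have inj_s : injective (enum_rank \o h).
  exact: inj_comp enum_rank_inj (bij_inj bij_h).
pose s := perm inj_s.
have -> : \matrix_(i, j) M (h i) (h j) =
    row_perm s (col_perm s (\matrix_(i, j < #|T|) M (enum_val i) (enum_val j))).
  by apply/matrixP => i j; rewrite !mxE !permE /= !enum_rankK.
rewrite row_permE col_permE !det_mulmx !det_perm odd_permV mulrCA.
by rewrite -signr_addb addbb mulr1.
Qed.

(* Every cofactor of the Laplacian is [t G]; this packages all of them. *)
Lemma matrix_tree (G : sgraph) n (h : 'I_n -> G) (u v : G -> algC) : bijective h ->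
  \det (\matrix_(i, j) ((deg (h i))%:R *+ (h i == h j) - (adj (h i) (h j))%:R
                        + u (h i) * v (h j)))
  = (\sum_x u x) * (\sum_x v x) * (t G)%:R.
Proof.
move=> bij_h.
rewrite (det_reindex (fun x y => (deg x)%:R *+ (x == y) - (adj x y)%:R + u x * v y)) //.
have /card_gt0P[r _] := sgraph_nonempty G.
rewrite -(det_laplacian_root r) -(sum_enum_val u) -(sum_enum_val v).
set M := (\matrix_(i, j) _).
have -> : M = laplacian G + (\col_i u (enum_val i)) *m (\row_j v (enum_val j)).
  apply/matrixP => i j; rewrite [RHS]mxE laplacianE !mxE big_ord1 !mxE.
  by rewrite (inj_eq enum_val_inj).
rewrite (det_add_rank1 _ _ (enum_rank r)) ?laplacian_1mul ?laplacian_mul1 //.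
by congr (_ * _ * _); apply: eq_bigr => i _; rewrite mxE.
Qed.

(** * Shifted Laplacians *)

(** The characteristic polynomial at -a, up to a sign that is spread over its linear factors; the
    eigenvalue [mu G 1 = 0] contributes the factor a. *)
Lemma det_shift_laplacian (G : sgraph) (a : algC) :
  \det (a%:M + laplacian G) = a * \prod_(2 <= i < #|G|.+1) (a + mu G i).
Proof.
have -> : a%:M + laplacian G = - ((- a)%:M - laplacian G).
  by rewrite rmorphN opprB opprK addrC.
rewrite -scaleN1r detZ.
have -> : \det ((- a)%:M - laplacian G) = (char_poly (laplacian G)).[- a].
  rewrite /char_poly -horner_evalE -det_map_mx; congr determinant.
  by apply/matrixP => i j; rewrite !mxE /= /horner_eval !hornerE hornerMn hornerX.
rewrite laplacian_char_poly horner_prod -size_laplacian_spectrum.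
have -> : (-1) ^+ size (laplacian_spectrum G) = \prod_(x <- laplacian_spectrum G) -1 :> algC.
  by rewrite big_const_seq count_predT iter_mulr_1.
rewrite -big_split /=.
under eq_bigr do rewrite hornerXsubC mulN1r opprB opprK addrC.
have: (0 < size (laplacian_spectrum G))%N.
  by rewrite size_laplacian_spectrum sgraph_nonempty.
rewrite (big_nth 0) => n0; rewrite big_ltn // -[_`_0]/(mu G 1) mu1_eq0 addr0.
by rewrite [in RHS]big_add1.
Qed.

(** The Laplacian kills the all-ones vector, so the constant matrix b is a + L times the constant
    matrix b / a. Factoring out a + L leaves a rank-one update of the identity. *)
Lemma det_shift_laplacian_const (G : sgraph) (a b : algC) : a != 0 ->
  \det (a%:M + laplacian G + const_mx b)
  = (1 + #|G|%:R * b / a) * \det (a%:M + laplacian G).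
Proof.
move=> a0.
have -> : a%:M + laplacian G + const_mx b =
  (a%:M + laplacian G) *m (1%:M + const_mx (b / a) *m (const_mx 1 : 'rV_ _)).
  rewrite mulmxDr mulmx1; congr (_ + _).
  have -> : const_mx (b / a) = (b / a) *: const_mx 1 :> 'cV_#|G|.
    by apply/matrixP => i j; rewrite !mxE mulr1.
  rewrite mulmxA -scalemxAr mulmxDl laplacian_mul1 addr0 mul_scalar_mx scalerA.
  by apply/matrixP => i j; rewrite !mxE big_ord1 !mxE !mulr1 mulfVK.
rewrite det_mulmx det_rank1 mulrC; congr ((1 + _) * _).
under eq_bigr do rewrite !mxE mul1r.
by rewrite sumr_const card_ord -[LHS]mulr_natl mulrA.
Qed.

(** * Edges and degrees *)

Lemma edgeP (G : sgraph) (e : {set G}) :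
  reflect (exists x y, adj x y /\ e = [set x; y]) (e \in edges G).
Proof.
apply: (iffP imsetP) => [[[x y]]|[x [y [xy ->]]]].
  by rewrite inE /= => xy ->; exists x, y.
by exists (x, y); rewrite ?inE.
Qed.

Lemma card_edge (G : sgraph) (e : {set G}) : e \in edges G -> #|e| = 2%N.
Proof.
case/edgeP=> x [y [xy ->]]; rewrite cards2.
by case: eqP xy => // ->; rewrite adj_irr.
Qed.

Lemma deg_edges (G : sgraph) (x : G) : #|[set e in edges G | x \in e]| = deg x.
Proof.
rewrite /deg -(card_in_imset (f := fun y => [set x; y])).
  apply: eq_card => e; rewrite !inE; apply/andP/imsetP => [[/edgeP[y [z [yz ->]]]] | [y]].
    by case/set2P=> xE; subst; [exists z | exists y]; rewrite ?inE // 1?adj_sym // setUC.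
  by rewrite inE => xy ->; rewrite mem_edges set21.
move=> y z; rewrite !inE => xy xz E.
have : y \in [set x; z] by rewrite -E set22.
by case/set2P=> // yx; rewrite yx adj_irr in xy.
Qed.

(** Two endpoints determine an edge. These are the off-diagonal entries of [R *m R^T] for the
    incidence matrix, as [deg_edges] gives the diagonal ones. *)
Lemma card_edges2 (G : sgraph) (x y : G) : x != y ->
  #|[set e in edges G | (x \in e) && (y \in e)]| = adj x y :> nat.
Proof.
move=> xy; have edge_xy (e : {set G}) : e \in edges G -> x \in e -> y \in e -> e = [set x; y].
  case/edgeP=> u [v [_ ->]] /set2P[] xE /set2P[] yE; subst; rewrite ?eqxx // in xy *.
  by rewrite setUC.
case: (boolP (adj x y)) => [axy | naxy].
  rewrite -[RHS](cards1 [set x; y]); apply: eq_card => e; rewrite !inE.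
  apply/and3P/eqP => [[ee xe ye] | ->]; first exact: edge_xy.
  by rewrite mem_edges set21 set22.
apply: eq_card0 => e; rewrite !inE; apply: contraNF naxy => /and3P[ee xe ye].
by rewrite -mem_edges -(edge_xy e).
Qed.

(** Double counting of incident vertex-edge pairs. *)
Lemma handshake (G : sgraph) (r : nat) : regular G r -> (2 * #|edges G| = #|G| * r)%N.
Proof.
move=> reg; have <- : (\sum_(e in edges G) \sum_(x in e) 1 = 2 * #|edges G|)%N.
  rewrite mulnC -sum_nat_const; apply: eq_bigr => e /card_edge <-.
  by rewrite sum1_card.
rewrite (exchange_big_dep xpredT) //= -sum_nat_const; apply: eq_bigr => x _.
by rewrite -(reg x) -deg_edges -sum1_card; apply: eq_bigl => e; rewrite inE.
Qed.

(** * The subdivision-vertex join *)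

Section SumIndex.
Variables (A B : finType) (m n : nat) (f : 'I_m -> A) (g : 'I_n -> B).

(** Lists a disjoint union so that its two parts match the blocks of [block_mx]. *)
Definition sum_index (i : 'I_(m + n)) : A + B :=
  match split i with inl j => inl (f j) | inr k => inr (g k) end.

Lemma sum_index_lshift j : sum_index (lshift n j) = inl (f j).
Proof. by rewrite /sum_index (unsplitK (inl j)). Qed.

Lemma sum_index_rshift k : sum_index (rshift m k) = inr (g k).
Proof. by rewrite /sum_index (unsplitK (inr k)). Qed.

Lemma sum_index_bij : bijective f -> bijective g -> bijective sum_index.
Proof.
move=> [f' fK f'K] [g' gK g'K].
exists (fun x => match x with inl a => lshift n (f' a) | inr b => rshift m (g' b) end).
  by move=> i; rewrite -(splitK i) /sum_index unsplitK; case: split => j /=; rewrite ?fK ?gK.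
by case=> x; rewrite ?sum_index_lshift ?sum_index_rshift ?f'K ?g'K.
Qed.

End SumIndex.

(** Schur complement: a column operation using the scalar block clears [C]. *)
Lemma det_block_scalar (R : fieldType) n m (A : 'M[R]_n) (B : 'M_(n, m))
    (C : 'M_(m, n)) c : c != 0 ->
  \det (block_mx A B C c%:M) = c ^+ m * \det (A - c^-1 *: (B *m C)).
Proof.
move=> c0; have: \det (block_mx A B C c%:M *m block_mx 1%:M 0 (- c^-1 *: C) 1%:M) =
    c ^+ m * \det (A - c^-1 *: (B *m C)).
  rewrite mulmx_block !mulmx1 !mulmx0 !add0r mul_scalar_mx scalerA mulrN mulfV //.
  rewrite scaleN1r subrr det_ublock det_scalar mulrC.
  by rewrite -scalemxAr scaleNr.
by rewrite det_mulmx det_lblock !det1 !mulr1.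
Qed.

Section SubdivisionVertexJoinCount.
Variables (G1 G2 : sgraph).
Let E : finType := {e : {set G1} | e \in edges G1}.

Lemma card_edge_type : #|E| = #|edges G1|.
Proof. by rewrite card_sig; apply: eq_card => e; rewrite inE. Qed.

Lemma sum_edge_type (F : {set G1} -> algC) :
  \sum_(e : E) F (val e) = \sum_(e in edges G1) F e.
Proof. by apply/esym; apply: big_sub. Qed.

Lemma sum_incidence (P : pred {set G1}) :
  \sum_(e : E) (P (val e))%:R = #|[set e in edges G1 | P e]|%:R :> algC.
Proof.
rewrite (sum_edge_type (fun e => (P e)%:R)) -sum1_card natr_sum [LHS]big_mkcond [RHS]big_mkcond /=.
by apply: eq_bigr => e _; rewrite inE; case: (e \in _) => //; case: (P e).
Qed.

Lemma deg_svjoin_vertex (x : G1) :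
  deg (inl (inl x) : svjoin G1 G2) = (deg x + #|G2|)%N.
Proof.
apply/eqP; rewrite -(eqr_nat algC) natrD deg_natr !big_sumType /=.
rewrite big1 // add0r; apply/eqP; congr (_ + _).
  by rewrite (sum_incidence (fun e => x \in e)) deg_edges.
by rewrite sumr_const.
Qed.

Lemma deg_svjoin_edge (e : E) : deg (inl (inr e) : svjoin G1 G2) = 2%N.
Proof.
apply/eqP; rewrite -(eqr_nat algC) deg_natr !big_sumType /=.
rewrite [X in _ + X + _]big1 // [X in _ + X]big1 // !addr0 -(card_edge (valP e)).
rewrite -sum1_card natr_sum [X in _ == X]big_mkcond /=; apply/eqP.
by apply: eq_bigr => x _; case: (x \in _).
Qed.

Lemma deg_svjoin_right (y : G2) :
  deg (inr y : svjoin G1 G2) = (#|G1| + deg y)%N.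
Proof.
apply/eqP; rewrite -(eqr_nat algC) natrD !deg_natr !big_sumType /=.
by rewrite [X in _ + X + _]big1 // addr0 sumr_const.
Qed.

Variable r1 : nat.
Hypothesis reg1 : regular G1 r1.

Let n1 := #|G1|.
Let n2 := #|G2|.

Lemma t_svjoin_regular :
  (n1 * (n1 + n2))%N%:R * (t (svjoin G1 G2))%:R =
  \det (n1%:R%:M + laplacian G2) *
  (2%:R ^+ #|edges G1| *
   \det (2%:R^-1 *: ((2 * n2)%:R%:M + laplacian G1 + const_mx 2%:R))).
Proof.
pose ev1 (i : 'I_#|G1|) : G1 := enum_val i.
pose evE (i : 'I_#|E|) : E := enum_val i.
pose ev2 (i : 'I_#|G2|) : G2 := enum_val i.
pose h : 'I_(#|G1| + #|E| + #|G2|) -> svjoin G1 G2 :=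
  sum_index (sum_index ev1 evE) ev2.
have bij_h : bijective h.
  by do !apply: sum_index_bij; apply: enum_val_bij.
(* Adding the product of [u] and [v] cancels the -1 entries in the rows of V(G1) and columns of
   V(G2), at the cost of an all-ones matrix in the V(G1) block. *)
pose u (x : svjoin G1 G2) : algC := if x is inl (inl _) then 1 else 0.
pose v (x : svjoin G1 G2) : algC := if x is inl (inr _) then 0 else 1.
have sum_u : \sum_x u x = n1%:R.
  rewrite !big_sumType /= [X in _ + X + _]big1 // [X in _ + X]big1 // !addr0.
  by rewrite sumr_const.
have sum_v : \sum_x v x = (n1 + n2)%N%:R.
  by rewrite !big_sumType /= [X in _ + X + _]big1 // addr0 natrD !sumr_const.
rewrite natrM -[X in X * _ * _]sum_u -[X in _ * X * _]sum_v.
rewrite -(@matrix_tree (svjoin G1 G2) _ h u v bij_h).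
have h1 i : h (lshift _ (lshift _ i)) = inl (inl (ev1 i)).
  by rewrite /h !sum_index_lshift.
have hE i : h (lshift _ (rshift _ i)) = inl (inr (evE i)).
  by rewrite /h sum_index_lshift sum_index_rshift.
have h2 i : h (rshift _ i) = inr (ev2 i).
  by rewrite /h sum_index_rshift.
pose R : 'M[algC]_(#|G1|, #|E|) := \matrix_(x, e) (ev1 x \in val (evE e))%:R.
set M := (\matrix_(i, j) _).
have -> : M = block_mx
   (block_mx ((r1 + n2)%:R%:M + const_mx 1) (- R) (- R^T) 2%:R%:M) 0
   (row_mx (const_mx (-1)) 0) (n1%:R%:M + laplacian G2).
  rewrite -[LHS]submxK; congr block_mx.
  - rewrite -[LHS]submxK; congr block_mx; apply/matrixP => i j; rewrite !mxE ?h1 ?hE /u /v.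
    + rewrite deg_svjoin_vertex reg1 !(inj_eq inl_inj) (inj_eq enum_val_inj).
      by rewrite subr0 mulr1.
    + by rewrite mulr0 addr0 sub0r.
    + by rewrite mul0r addr0 sub0r.
    + rewrite deg_svjoin_edge (inj_eq inl_inj) (inj_eq inr_inj) (inj_eq enum_val_inj).
      by rewrite mul0r subr0 addr0.
  - apply/matrixP => i j; rewrite !mxE h2 /u /v.
    by case: (split_ordP i) => k ->; rewrite ?h1 ?hE /= ?mulr1 ?mul0r ?sub0r ?addNr ?subr0 ?addr0.
  - apply/matrixP => i j; rewrite !mxE h2 /u /v.
    case: (split_ordP j) => k ->; rewrite ?h1 ?hE ?row_mxEl ?row_mxEr mul0r !mxE addr0 sub0r //=.
    by rewrite oppr0.
  - apply/matrixP => i j; rewrite [RHS]mxE laplacianE !mxE !h2 /u /v.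
    rewrite deg_svjoin_right (inj_eq inr_inj) (inj_eq enum_val_inj) mul0r addr0.
    by rewrite natrD mulrnDl addrA.
rewrite det_lblock mulrC det_block_scalar ?pnatr_eq0 //.
congr (_ * _); congr (_ * _); first by rewrite card_edge_type.
congr determinant.
rewrite mulNmx mulmxN opprK.
have -> : R *m R^T = r1%:R%:M + adjacency_mx G1.
  apply/matrixP => x y; rewrite !mxE.
  under eq_bigr do rewrite !mxE -natrM mulnb.
  rewrite (sum_enum_val (fun e : E => ((ev1 x \in val e) && (ev1 y \in val e))%:R : algC)).
  rewrite (sum_incidence (fun e => (ev1 x \in e) && (ev1 y \in e))).
  have [<- | xy] := eqVneq x y.
    rewrite adj_irr addr0 -(reg1 (ev1 x)) -deg_edges; congr (_%:R).
    by apply: eq_card => e; rewrite !inE andbb.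
  by rewrite card_edges2 ?mulr0n ?add0r // (inj_eq enum_val_inj).
(* With J all ones, (r1 + n2) + J - (r1 + A) / 2 = (2 n2 + (r1 - A) + 2 J) / 2, and r1 - A is the
   Laplacian of [G1] by regularity. *)
apply/matrixP => x y; rewrite !mxE (reg1 _) natrD natrM.
by case: (x == y); rewrite ?mulr1n ?mulr0n; field.
Qed.

End SubdivisionVertexJoinCount.

Unset Implicit Arguments.

(* The exponent m1 - n1 is an integer: it is negative when r1 < 2. *)
Theorem corollary2p9 (G1 G2 : sgraph) (n1 m1 n2 r1 : nat)
    (hn1 : #|G1| = n1) (hm1 : #|edges G1| = m1) (hn2 : #|G2| = n2)
    (hr1 : regular G1 r1) :
  (t (svjoin G1 G2))%:R =
    2%:R ^ (m1%:Z - n1%:Z) * (2 * n1 + 2 * n2 + n1 * r1)%N%:R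
    * (\prod_(2 <= i < n2.+1) (n1%:R + mu G2 i))
    * (\prod_(2 <= i < n1.+1) ((2 * n2)%N%:R + mu G1 i))
    / (m1 + n1 + n2)%N%:R :> algC.
Proof.
have n1_gt0 : (0 < n1)%N by rewrite -hn1 sgraph_nonempty.
have n2_gt0 : (0 < n2)%N by rewrite -hn2 sgraph_nonempty.
have nz k : (0 < k)%N -> k%:R != 0 :> algC by rewrite pnatr_eq0 -lt0n.
have n1_nz := nz _ n1_gt0; have n2_nz := nz _ n2_gt0.
have := t_svjoin_regular G2 hr1.
rewrite detZ det_shift_laplacian_const; last first.
  by rewrite nz // hn2 muln_gt0.
rewrite !det_shift_laplacian hn1 hm1 hn2.
(* By the handshake lemma n1 r1 = 2 m1, so this factor over the denominator is just 2. *)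
have -> : (2 * n1 + 2 * n2 + n1 * r1 = 2 * (m1 + n1 + n2))%N.
  by rewrite -{2}hn1 -(handshake hr1) hm1 -!mulnDr addnC addnA.
rewrite expfzDr ?nz // -invr_expz -!exprnP exprVn [(2 * (_ + _))%N%:R]natrM.
move: (\prod_(2 <= i < n2.+1) _) (\prod_(2 <= i < n1.+1) _) => P2 P1.
rewrite !natrM !natrD.
have n12_nz : n1%:R + n2%:R != 0 :> algC by rewrite -natrD nz // addn_gt0 n1_gt0.
have N_nz : m1%:R + n1%:R + n2%:R != 0 :> algC.
  by rewrite -!natrD nz // addn_gt0 n2_gt0 orbT.
have p_nz : 2 ^+ n1 != 0 :> algC by rewrite expf_neq0 ?nz.
move: (t _)%:R (2 ^+ m1) (2 ^+ n1) p_nz => T q p p_nz tE.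
(* In [tE], n1 comes from the shift of [G2]; the shift 2 n2 of [G1] times the rank-one factor 1 + 2
   n1 / (2 n2) is 2 (n1 + n2). Cancelling n1 (n1 + n2) leaves the constant 2. *)
apply: (mulfI (mulf_neq0 n1_nz n12_nz)); rewrite tE; field.
by rewrite p_nz N_nz n2_nz.
Qed.
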